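(* For every $\alpha\in(0,1]$ there is $\mu_0>0$ such that for every $0<\mu\leq\mu_0$ there is $\varepsilon_0>0$ such that for every $0<\varepsilon\leq\varepsilon_0$ there is $c_0>0$ such that for every $0<c\leq c_0$ there is $n_0$ such that the following holds for all $n\geq n_0$. Let $D$ be an $n$-vertex digraph with $\delta^0(D)\geq(1/2+\alpha)n$. Let $T$ be an oriented tree with $\mu n$ vertices and $\Delta^\pm(T)\leq cn/\log n$, and let $t\in V(T)$. Then $V(D)$ contains a vertex set $A$ of size $(\mu-\varepsilon)n$ and a vertex $v\in A$ such that, for every set $B\subset V(D)$ with $A\subset B$ and $|B|=\mu n$, the digraph $D[B]$ contains a copy of $T$ in which $t$ is copied to $v$.
   Context: Digraphs have edges that are ordered pairs of distinct vertices; $\delta^0(D)$ is the minimum over all vertices of the minimum of the in-degree and out-degree. An oriented tree is a tree with each edge given a direction; $\Delta^\pm(T)$ is the maximum degree of its underlying undirected tree. A copy of $T$ in $D$ is an injective map $V(T)\to V(D)$ mapping each directed edge of $T$ to an edge of $D$ with the same direction; ''$t$ is copied to $v$'' means $t$ is mapped to $v$. $D[B]$ is the subdigraph induced on $B$. Quantities such as $\mu n$ and $(\mu-\varepsilon)n$ are assumed to be integers (rounding is ignored). *)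

(* Defs.v *)
From mathcomp Require Import all_boot.

Set Implicit Arguments.
Unset Strict Implicit.
Unset Printing Implicit Defensive.

(* A digraph is an irreflexive relation on a finType; antiparallel edges are
   allowed. *)
Section Digraph.
Variables (V : finType) (D : rel V).

Definition outdeg (x : V) : nat := #|[pred y | D x y]|.

Definition indeg (x : V) : nat := #|[pred y | D y x]|.

(* All degrees are at most #|V|, so the default value #|V| of the iterated
   minimum never affects the result when V is nonempty. *)
Definition min_semidegree : nat :=
  \big[minn/#|V|]_(x : V) minn (indeg x) (outdeg x).

Definition underlying : rel V := [rel x y | D x y || D y x].

Definition max_total_degree : nat :=
  \max_(x : V) #|[pred y | underlying x y]|.

Definition induced (B : {set V}) : rel {x : V | x \in B} :=
  [rel x y | D (val x) (val y)].

End Digraph.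

Arguments induced {V} D B.

Definition is_tree (V : finType) (e : rel V) : Prop :=
  [/\ 0 < #|V|, symmetric e, irreflexive e,
      forall x y : V, connect e x y
    & forall s : seq V, ucycle e s -> size s <= 2].

(* The first clause says that each edge of the underlying tree carries only
   one direction; with x = y it also excludes loops. *)
Definition is_oriented_tree (V : finType) (T : rel V) : Prop :=
  (forall x y : V, ~~ (T x y && T y x)) /\ is_tree (underlying T).

Definition is_copy (U V : finType) (T : rel U) (D : rel V) (f : U -> V) : Prop :=
  injective f /\ (forall x y : U, T x y -> D (f x) (f y)).

(* Main.v *)
(* List the vertices of T so that each new one has a single earlier neighbour,
   and let S be an independent set of vertices of degree at most 3 whose closed
   neighbourhoods lie in the prefix of length |A|.  Embed the prefix vertex by
   vertex.  A vertex placed at random in the free part of the required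
   neighbourhood falls into any other neighbourhood of D with probability at
   least alpha; so a Chernoff bound, derandomised through conditional
   expectations of exponential moments, lets us choose the embedding such that
   for all vertices b, w of D and each direction there are at least |B \ A|
   vertices z of S which may be moved to b and whose image is a neighbour of w.
   The degree bound n / log n is what keeps the exponential moments under
   control.  To add a vertex x with parent placed at w, take an unused b in B,
   move such a z to b and put x where z was. *)
Require Import Defs.
From mathcomp Require Import all_boot all_order all_algebra.
From mathcomp Require Import reals sequences exp.
From mathcomp Require Import zify ring lra.

Set Implicit Arguments.
Unset Strict Implicit.
Unset Printing Implicit Defensive.

Import Order.TTheory GRing.Theory Num.Theory.

(** * Leaf-by-leaf orderings of a tree, and the switching set *)

Section TreeOrder.
Variables (U : finType) (e : rel U).
Hypotheses (e_sym : symmetric e) (e_irr : irreflexive e).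

(* The newest vertex comes first, the root last. *)
Fixpoint tree_order (s : seq U) : bool :=
  if s is x :: s' then
    [&& x \notin s', nilp s' || (count (e x) s' == 1) & tree_order s']
  else true.

Lemma tree_order_uniq s : tree_order s -> uniq s.
Proof. by elim: s => //= x s IH /and3P[-> _ /IH]. Qed.

Lemma tree_order_catr s1 s2 : tree_order (s1 ++ s2) -> tree_order s2.
Proof. by elim: s1 => //= x s IH /and3P[_ _ /IH]. Qed.

Lemma tree_order_parent x s :
  tree_order (x :: s) -> s != [::] -> exists2 y, y \in s & e x y.
Proof.
move=> /= /and3P[_ + _]; rewrite /nilp size_eq0 => /orP[->//|/eqP c1 _].
by apply/hasP; rewrite has_count c1.
Qed.

Lemma tree_order_parent_unique x s y z :
  tree_order (x :: s) -> y \in s -> z \in s -> e x y -> e x z -> y = z.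
Proof.
move=> /= /and3P[_ + o] ys zs exy exz.
rewrite /nilp size_eq0 => /orP[/eqP s0|]; first by rewrite s0 in ys.
rewrite -size_filter => /eqP sz.
have : y \in filter (e x) s by rewrite mem_filter exy.
have : z \in filter (e x) s by rewrite mem_filter exz.
by case: (filter _ _) sz => [|u []]//= _; rewrite !inE => /eqP-> /eqP->.
Qed.

Lemma tree_order_path s x y : tree_order s -> x \in s -> y \in s ->
  exists p, [/\ path e x p, last x p = y & {subset p <= s}].
Proof.
elim: s x y => //= a s IH x y o.
have /and3P[_ _ os] := o.
have par z : z \in s -> exists2 b, b \in s & e a b.
  by move=> zs; apply: tree_order_parent o _; case: (s) zs.
have sub p : {subset p <= s} -> {subset p <= a :: s}.
  by move=> ps z zp; rewrite inE ps ?orbT.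
rewrite !inE => /orP[/eqP->|xs] /orP[/eqP->|ys].
- by exists [::].
- have [b bs eab] := par _ ys; have [p [pp lp ps]] := IH b y os bs ys.
  exists (b :: p) => /=; rewrite eab; split=> // z.
  by rewrite in_cons => /orP[/eqP->|zp]; rewrite inE ?bs ?ps ?orbT.
- have [b bs eab] := par _ xs; have [p [pp lp ps]] := IH x b os xs bs.
  exists (rcons p a); rewrite rcons_path lp pp last_rcons e_sym eab.
  by split=> // z; rewrite mem_rcons !inE => /orP[->//|/ps->]; rewrite orbT.
- have [p [pp lp ps]] := IH x y os xs ys.
  by exists p; split => //; exact: sub.
Qed.

Hypothesis e_acyclic : forall s : seq U, ucycle e s -> size s <= 2.

(** Two neighbours of [x] in [s] would be joined by a simple path inside [s], which together with
    [x] closes a cycle of length at least 3. *)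
Lemma tree_order_cons x y s : tree_order s -> x \notin s -> y \in s -> e x y ->
  tree_order (x :: s).
Proof.
move=> o xs ys exy /=; rewrite xs o andbT /=; apply/orP; right.
rewrite eqn_leq -has_count; apply/andP; split; last by apply/hasP; exists y.
rewrite leqNgt; apply/negP; rewrite -size_filter.
have := filter_uniq (e x) (tree_order_uniq o).
have sub z : z \in filter (e x) s -> (z \in s) && e x z.
  by rewrite mem_filter andbC.
case: (filter _ _) sub => [|u [|w r]] //= sub.
rewrite !inE negb_or => /andP[/andP[uw _] _] _.
have /andP[us eu] := sub u (mem_head _ _).
have /andP[ws ew] : (w \in s) && e x w by apply: sub; rewrite !inE eqxx orbT.
have [p [pp lp ps]] := tree_order_path o us ws.
case/shortenP: pp lp => q pq uq qp lq.
have qs : {subset q <= s} by move=> z /qp/ps.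
have /e_acyclic : ucycle e [:: x, u & q].
  rewrite /ucycle /= eu rcons_path pq lq e_sym ew -/(uniq (u :: q)) uq !andbT /=.
  rewrite inE negb_or (contraNN (qs x) xs) andbT.
  by apply: contraNneq xs => ->.
by case: q lq uw {pq uq qp qs} => //= ->; rewrite eqxx.
Qed.

(** The list grows from the root [t]: if no edge left it, it would be closed under adjacency, hence
    everything by connectedness. With [t] last, every nonempty suffix contains it. *)
Lemma tree_order_exists t : (forall x y, connect e x y) ->
  exists s, [/\ tree_order (rcons s t) & size (rcons s t) = #|U|].
Proof.
move=> conn.
suff [s [o sz]] : exists s, tree_order (rcons s t) /\ size s = #|U|.-1.
  exists s; split=> //; rewrite size_rcons sz prednK //.
  by apply/card_gt0P; exists t.
have : #|U|.-1 < #|U| by rewrite prednK //; apply/card_gt0P; exists t.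
elim: #|U|.-1 => [|k IH] kU; first by exists [::].
have [s [o sz]] := IH (ltnW kU).
have uo := tree_order_uniq o.
case: (boolP [exists x, [exists y, [&& x \notin rcons s t, y \in rcons s t & e x y]]]).
  move=> /existsP[x /existsP[y /and3P[xs ys exy]]].
  exists (x :: s); rewrite /= sz; split=> //.
  by apply: (tree_order_cons o xs ys exy).
move=> /existsPn nex; exfalso.
have cl : closed e [pred z | z \in rcons s t].
  apply: intro_closed => [|x y exy xs]; first exact: sym_connect_sym.
  have /existsPn/(_ x) := nex y; rewrite [e y x]e_sym exy andbT.
  by rewrite negb_and negbK => /orP[//|/negP].
have : #|U| <= #|[pred z | z \in rcons s t]|.
  apply/subset_leq_card/subsetP => x _.
  by rewrite -(closed_connect cl (conn t x)) inE mem_rcons mem_head.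
by rewrite (card_uniqP uo) size_rcons sz leqNgt kU.
Qed.

Lemma tree_order_edges s : tree_order s ->
  \sum_(x <- s) count (e x) s <= 2 * size s.
Proof.
elim: s => [|a s IH]; first by rewrite big_nil.
move=> /= /and3P[_ c1 /IH{}IH].
have c2 : count (e a) s <= 1.
  by case/orP: c1 => [|/eqP->]//; rewrite /nilp size_eq0 => /eqP->.
rewrite big_cons /= e_irr add0n big_split /=.
have -> : \sum_(i <- s) e i a = count (e a) s.
  by rewrite -sum1_count [RHS]big_mkcond /=; apply: eq_bigr => i _; rewrite e_sym; case: e.
lia.
Qed.

(** A new vertex takes the colour opposite to its parent's. A colour class will make the switching
    set independent. *)
Lemma tree_order_coloring s : tree_order s ->
  exists col : U -> bool, {in s &, forall x y, e x y -> col x != col y}.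
Proof.
elim: s => [|a s IH] o; first by exists xpredT.
have /and3P[an _ /IH[col colP]] := o.
case: (eqVneq s [::]) => [->|s0].
  by exists xpredT => x y; rewrite !inE => /eqP-> /eqP->; rewrite e_irr.
have [y ys eay] := tree_order_parent o s0.
have nbr z : z \in s -> e a z -> z = y.
  by move=> zs eaz; apply: tree_order_parent_unique o zs ys eaz eay.
have na z : z \in s -> (z == a) = false.
  by move=> zs; apply: contraNF an => /eqP<-.
exists [eta col with a |-> ~~ col y] => x z; rewrite !inE /=.
move=> /orP[/eqP->|xs] /orP[/eqP->|zs]; rewrite ?eqxx ?e_irr ?na //.
- by move=> /(nbr _ zs)->; case: (col y).
- by rewrite e_sym => /(nbr _ xs)->; case: (col y).
- exact: colP.
Qed.

(** Each vertex of [s2] has at most one neighbour further down the list, so it accounts for at most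
    one vertex of [s1]. *)
Lemma count_prefix_boundary s2 s1 : tree_order (s2 ++ s1) ->
  count (fun z => has (e z) s2) s1 <= size s2.
Proof.
elim: s2 => [|a s2 IH] /=; first by rewrite count_pred0.
move=> /and3P[_ c1 /IH{}IH].
have c2 : count (e a) (s2 ++ s1) <= 1.
  by case/orP: c1 => [|/eqP->]//; rewrite /nilp size_eq0 => /eqP->.
rewrite count_cat in c2.
have := count_predUI (e^~ a) (fun z => has (e z) s2) s1.
have -> : count (e^~ a) s1 = count (e a) s1 by apply: eq_count => z; rewrite e_sym.
move=> uE; apply: (@leq_trans (count (predU (e^~ a) (fun z => has (e z) s2)) s1)) => //.
lia.
Qed.

(** The degrees sum to at most [2 * #|U|], so at most half of the vertices have degree 4 or more. *)
Lemma card_low_degree s : tree_order s -> size s = #|U| ->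
  #|U| <= 2 * #|[set x | #|[pred y | e x y]| <= 3]|.
Proof.
move=> o sz.
have us := tree_order_uniq o.
have ms x : x \in s.
  have /subset_cardP : #|s| = #|U| by rewrite (card_uniqP us).
  by rewrite subset_predT => /(_ isT) ->.
have dE x : count (e x) s = #|[pred y | e x y]|.
  rewrite -size_filter -(card_uniqP (filter_uniq _ us)).
  by apply: eq_card => y; rewrite mem_filter ms andbT !inE.
have := tree_order_edges o; rewrite sz.
rewrite (eq_bigr _ (fun x _ => dE x)) big_uniq //= => H.
set L := [set x | _].
have : 4 * #|~: L| <= 2 * #|U|.
  apply: leq_trans H.
  rewrite mulnC -sum_nat_const (eq_bigl [in ~: L]) //.
  rewrite [X in _ <= X](bigID [in ~: L]) /=.
  apply: leq_trans (leq_addr _ _).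
  rewrite [X in _ <= X](eq_bigl [in ~: L]); last by move=> x; rewrite ms.
  by apply: leq_sum => x; rewrite !inE -ltnNge.
by rewrite -(cardsC L); lia.
Qed.

(** The larger colour class among the vertices of degree at most 3 holds a quarter of all vertices.
    Discarding [t], [s2] and the vertices of [s1] with a neighbour in [s2] costs at most
    [2 * size s2 + 1]. *)
Lemma exists_switching_set s2 s1 t :
  tree_order (s2 ++ s1) -> size (s2 ++ s1) = #|U| ->
  exists S : {set U},
    [/\ t \notin S, {in S, forall z, #|[pred y | e z y]| <= 3},
        {in S, forall z, z \in s1},
        {in S, forall z y, e z y -> (y \in s1) && (y \notin S)}
      & #|U| <= 4 * (#|S| + 2 * size s2 + 1)].
Proof.
move=> o sz.
have us := tree_order_uniq o.
have ms x : (x \in s2) || (x \in s1).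
  have /subset_cardP : #|s2 ++ s1| = #|U| by rewrite (card_uniqP us).
  by rewrite subset_predT => /(_ isT) /(_ x); rewrite mem_cat inE.
have [col colP] := tree_order_coloring o.
have cardL := card_low_degree o sz.
set L := [set x | _] in cardL.
pose C b := [set x in L | col x == b].
have [b cardC] : exists b, #|U| <= 4 * #|C b|.
  have cC : #|C true| + #|C false| = #|L|.
    rewrite -(cardsID [set x | col x] L); congr (_ + _); apply: eq_card => x;
      by rewrite !inE; case: (col x); rewrite ?andbT ?andbF.
  case: (leqP #|C true| #|C false|) => ?; [exists false|exists true]; lia.
pose Q := [set z in s1 | has (e z) s2].
pose Bad := t |: ([set x in s2] :|: Q).
have cQ : #|Q| <= size s2.
  apply: leq_trans (count_prefix_boundary o).
  rewrite -size_filter; apply: leq_trans (card_size _).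
  by apply/subset_leq_card/subsetP => z; rewrite !inE mem_filter andbC.
have cB : #|Bad| <= 2 * size s2 + 1.
  rewrite cardsU1 addnC leq_add ?leq_b1 //.
  apply: leq_trans (leq_card_setU _ _) _.
  rewrite mul2n -addnn leq_add //.
  by apply: leq_trans (card_size s2); apply/subset_leq_card/subsetP => z; rewrite inE.
have inS z : z \in C b :\: Bad ->
    [/\ z != t, z \in s1, ~~ has (e z) s2, #|[pred y | e z y]| <= 3 & col z = b].
  rewrite !inE !negb_or => /andP[/andP[-> /andP[zs2 nQ]] /andP[-> /eqP->]].
  have zs1 : z \in s1 by have := ms z; rewrite (negbTE zs2).
  by move: nQ; rewrite zs1 /= => ->.
exists (C b :\: Bad); split.
- by rewrite !inE eqxx.
- by move=> z /inS[].
- by move=> z /inS[].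
- move=> z zS y ezy; have [_ zs1 nh _ cz] := inS _ zS.
  have ys1 : y \in s1.
    by case/orP: (ms y) => // ys2; case/hasP: nh; exists y.
  rewrite ys1 /=; apply/negP => /inS[_ _ _ _ cy].
  have := colP z y; rewrite !mem_cat !ms cz cy eqxx.
  by move=> /(_ isT isT ezy).
- have := cardsID Bad (C b).
  have := subset_leq_card (subsetIr (C b) Bad); lia.
Qed.

End TreeOrder.

(** * Exponential moments and averaging *)

Local Open Scope ring_scope.

(** Since [expR u >= 1 + u], it suffices that [(1 + u) * (1 - u + 2 * u ^+ 2) = 1 + u ^+ 2 * (1 + 2
    * u)] is at least 1. *)
Lemma expRN_le_quadratic (R : realType) (u : R) :
  - 2^-1 <= u -> expR (- u) <= 1 - u + 2 * u ^+ 2.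
Proof.
move=> hu; have up : 0 < 1 + u by lra.
have pe : 0 < expR u by exact: expR_gt0.
have h1 := expR_ge1Dx u.
rewrite expRN -[X in X <= _]mul1r ler_pdivrMr //.
have h2 : 0 <= 1 - u + 2 * u ^+ 2 by nra.
apply: le_trans (ler_wpM2l h2 h1).
have : 0 <= u ^+ 2 * (1 + 2 * u) by apply: mulr_ge0; [exact: sqr_ge0|lra].
by nra.
Qed.

(** After the quadratic bound the linear terms sum to [- \sum w v <= 0] and drop out; then
    [1 + y <= expR y]. *)
Lemma sum_expRN_le (R : realType) (V : finType) (C : {set V}) (w : V -> R) (d : R) :
  d <= 2^-1 -> (forall v, `|w v| <= d) -> 0 <= \sum_(v in C) w v ->
  \sum_(v in C) expR (- w v) <= #|C|%:R * expR (2 * d ^+ 2).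
Proof.
move=> d2 wd w0.
apply: (@le_trans _ _ (\sum_(v in C) ((1 + 2 * d ^+ 2) - w v))).
  apply: ler_sum => v _.
  have := wd v; rewrite ler_norml => /andP[h1 h2].
  have := @expRN_le_quadratic R (w v); move=> /(_ ltac:(lra)) h.
  have : 0 <= (d - w v) * (d + w v) by apply: mulr_ge0; lra.
  by move=> dw; apply: (le_trans h); nra.
rewrite sumrB sumr_const -[_ *+ #|C|]mulr_natl.
have : #|C|%:R * (1 + 2 * d ^+ 2) <= #|C|%:R * expR (2 * d ^+ 2).
  by apply: ler_wpM2l => //; exact: expR_ge1Dx.
lra.
Qed.

Lemma exists_le_average (R : realType) (V : finType) (C : {set V}) (F : V -> R) (b : R) :
  (0 < #|C|)%N -> \sum_(v in C) F v <= #|C|%:R * b -> exists2 v, v \in C & F v <= b.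
Proof.
move=> C0 h; apply/exists_inP; apply: contraLR h.
move=> /exists_inPn h; rewrite -ltNge mulr_natl -sumr_const.
have [v0 v0C] := card_gt0P C0.
apply: ltr_sum.
  by apply/hasP; exists v0; rewrite ?mem_index_enum.
by move=> v vC; rewrite ltNge h.
Qed.

(** * The method of conditional expectations *)

Section Potential.
Variables (R : realType) (U V I : finType) (S : {set U}) (N : U -> {set U}).
Variables (G : I -> U -> U -> pred V) (a lam : R).
Hypotheses (a01 : 0 <= a <= 1) (lam0 : 0 <= lam).

(* Conditional probability that [z] ends up good for [i], when the vertices of [s]
   are already placed by [f] and each later one is good with probability [a]. *)
Definition weight (s : seq U) (f : U -> V) (i : I) (z : U) : R :=
  \prod_(x in N z) (if x \in s then (G i z x (f x))%:R else a).

(** The pessimistic estimator of a Chernoff bound for the lower tail of the number of good [z],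
    summed over all tests [i] so that a single choice serves them all. *)
Definition potential (s : seq U) (f : U -> V) : R :=
  \sum_i expR (- (lam * \sum_(z in S) weight s f i z)).

Definition touched (x : U) : {set U} := [set z in S | x \in N z].

Let factor01 (s : seq U) f i z x : 0 <= (if x \in s then (G i z x (f x))%:R else a) <= 1.
Proof. by case: ifP => // _; case: G; rewrite ?lexx ?ler01. Qed.

(** Only the factor at [x] changes, from [a] to 0 or 1. The additive form isolates the increment,
    whose mean over [v] is what [potential_step] controls. *)
Lemma weight_cons s f i z x v : x \notin s ->
  weight (x :: s) [eta f with x |-> v] i z = weight s f i z +
   (if x \in N z then (\prod_(y in N z | y != x)
       (if y \in s then (G i z y (f y))%:R else a)) * ((G i z x v)%:R - a) else 0).
Proof.
move=> xs.
have same y : y != x ->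
    (if y \in x :: s then (G i z y ([eta f with x |-> v] y))%:R else a) =
    (if y \in s then (G i z y (f y))%:R else a).
  by move=> /negbTE yx; rewrite inE /= yx.
case: ifP => xN; last first.
  rewrite addr0; apply: eq_bigr => y yN; apply: same.
  by apply: contraTneq yN => ->; rewrite xN.
rewrite /weight (bigD1 x) //= [in RHS](bigD1 x) //= inE eqxx /= (negbTE xs).
rewrite [X in _ * X = _](eq_bigr (fun y => if y \in s then (G i z y (f y))%:R else a));
  last by move=> y /andP[_]; exact: same.
ring.
Qed.

(** For [v] uniform in [C] every weight has an increment of nonnegative mean, and each exponent
    changes by at most [lam * #|touched x|]. So [sum_expRN_le] bounds the average new potential, and
    some [v] does no worse than the average. *)
Lemma potential_step s f x (C : {set V}) :
    x \notin s -> (0 < #|C|)%N -> lam * #|touched x|%:R <= 2^-1 ->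
    (forall i z, a * #|C|%:R <= #|[set v in C | G i z x v]|%:R) ->
  exists2 v, v \in C &
    potential (x :: s) [eta f with x |-> v] <=
    potential s f * expR (2 * (lam * #|touched x|%:R) ^+ 2).
Proof.
move=> xs C0 small dense; apply: exists_le_average => //.
rewrite exchange_big /= mulrA mulr_sumr mulr_suml; apply: ler_sum => i _.
pose rest z := \prod_(y in N z | y != x) (if y \in s then (G i z y (f y))%:R else a).
pose delta v := \sum_(z in touched x) rest z * ((G i z x v)%:R - a).
have rest01 z : 0 <= rest z <= 1.
  apply/andP; split; first by apply: prodr_ge0 => y _; case/andP: (factor01 s f i z y).
  by apply: prodr_ile1 => y _.
have E v : \sum_(z in S) weight (x :: s) [eta f with x |-> v] i z =
    \sum_(z in S) weight s f i z + delta v.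
  have -> : delta v = \sum_(z in S)
      if x \in N z then rest z * ((G i z x v)%:R - a) else 0.
    by rewrite -big_mkcondr; apply: eq_bigl => z; rewrite inE.
  rewrite -big_split /=.
  by apply: eq_bigr => z _; rewrite weight_cons.
under eq_bigr => v _ do rewrite E mulrDr opprD expRD.
rewrite -mulr_sumr [_%:R * _]mulrC -mulrA ler_wpM2l ?expR_ge0 //.
apply: sum_expRN_le => [//|v|].
  rewrite normrM (ger0_norm lam0) ler_wpM2l //.
  apply: le_trans (ler_norm_sum _ _ _) _.
  rewrite -sum1_card natr_sum; apply: ler_sum => z _.
  have /andP[r0 r1] := rest01 z; rewrite normrM (ger0_norm r0).
  rewrite -[X in _ <= X]mul1r; apply: ler_pM => //.
  have /andP[a0 a1] := a01; rewrite ler_norml; case: G => /=; rewrite ?mulr1n ?mulr0n; lra.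
rewrite -mulr_sumr; apply: mulr_ge0 => //.
rewrite exchange_big /=; apply: sumr_ge0 => z _.
rewrite -mulr_sumr; apply: mulr_ge0; first by case/andP: (rest01 z).
rewrite sumrB sumr_const -mulr_natr -natr_sum subr_ge0.
apply: le_trans (dense i z) _.
rewrite -sum1_card ler_nat (eq_bigl (fun v => (v \in C) && G i z x v)).
  rewrite big_mkcondr /=; apply: leq_sum => v _; by case: G.
by move=> v; rewrite inE.
Qed.

Lemma potential_nil f (tau : R) :
  tau <= \sum_(z in S) a ^+ #|N z| ->
  potential [::] f <= #|I|%:R * expR (- (lam * tau)).
Proof.
move=> h; rewrite mulr_natl -sumr_const; apply: ler_sum => i _.
rewrite ler_expR lerN2 ler_wpM2l //.
apply: le_trans h _; apply: ler_sum => z _.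
by rewrite /weight prodr_const.
Qed.

(** Each summand is at most the whole potential, so the bound holds for every [i]. Once all of [N z]
    is placed, [weight] is at most the indicator that [z] is good. *)
Lemma potential_good s f i (tau : R) :
  potential s f < expR (- (lam * tau)) -> {in S, forall z, {subset N z <= s}} ->
  tau < #|[set z in S | [forall x in N z, G i z x (f x)]]|%:R.
Proof.
move=> h Ns.
have : expR (- (lam * \sum_(z in S) weight s f i z)) < expR (- (lam * tau)).
  apply: le_lt_trans h; rewrite /potential (bigD1 i) //= lerDl.
  by apply: sumr_ge0 => j _; exact: expR_ge0.
rewrite ltr_expR ltrN2 => h'.
have /lt_le_trans : tau < \sum_(z in S) weight s f i z.
  by rewrite ltNge; apply: contraTN h' => h'; rewrite -leNgt ler_wpM2l.
apply; rewrite -sum1_card natr_sum [X in _ <= X](eq_bigl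
  (fun z => (z \in S) && [forall x in N z, G i z x (f x)])); last first.
  by move=> z; rewrite inE.
rewrite big_mkcondr; apply: ler_sum => z zS.
case: ifPn => [_|].
  by rewrite /weight; apply: prodr_ile1 => x _; exact: factor01.
case/forall_inPn => x xN nG.
by rewrite /weight (bigD1 x) //= (Ns z zS x xN) (negbTE nG) mul0r.
Qed.

End Potential.

(** * Partial copies, switching and the greedy embedding *)

Section Copies.
Variables (U V : finType) (T : rel U) (D : rel V).
Hypothesis T_asym : forall x y : U, ~~ (T x y && T y x).
Let e := underlying T.

Definition partial_copy (s : seq U) (f : U -> V) : Prop :=
  {in s &, injective f} /\ {in s &, forall x y, T x y -> D (f x) (f y)}.

Definition nbr (out : bool) (w : V) : {set V} := [set v | if out then D w v else D v w].

Let T_irr x : T x x = false.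
Proof. by apply/negP => h; have := T_asym x x; rewrite h. Qed.

Lemma underlying_sym : symmetric e.
Proof. by move=> x y; rewrite /e /underlying /= orbC. Qed.

Lemma underlying_irr : irreflexive e.
Proof. by move=> x; rewrite /e /underlying /= T_irr. Qed.

(** Here [x] may already lie in [s], so this covers both adding a vertex and moving a placed one. *)
Lemma partial_copy_update s f x v :
    partial_copy s f -> {in s, forall y, f y != v} ->
    {in s, forall y, y != x -> e x y -> v \in nbr (T y x) (f y)} ->
  partial_copy (x :: s) [eta f with x |-> v].
Proof.
move=> [inj hom] vs adj; split=> y z; rewrite !inE /=.
  case: (eqVneq y x) => [->|yx] /=; case: (eqVneq z x) => [->|zx] //=.
  - by move=> _ zs /esym/eqP; rewrite (negbTE (vs _ zs)).
  - by move=> ys _ /eqP; rewrite (negbTE (vs _ ys)).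
  - exact: inj.
case: (eqVneq y x) => [->|yx] /=; case: (eqVneq z x) => [->|zx] //=.
- by rewrite T_irr.
- move=> _ zs Txz; have := T_asym x z; rewrite Txz /= => nT.
  by have := adj z zs zx; rewrite /e /underlying /= Txz inE (negbTE nT); apply.
- by move=> ys _ Tyx; have := adj y ys yx; rewrite /e /underlying /= Tyx orbT inE; apply.
- exact: hom.
Qed.

(* [z], placed at [f z], may be moved to the vertex [i.1.1], which then frees
   [f z] for a new neighbour of the vertex placed at [i.1.2]. *)
Definition switch_test (i : V * V * bool) (z x : U) : pred V :=
  [in if x == z then nbr i.2 i.1.2 else nbr (T z x) i.1.1].

Definition closed_nbhd (z : U) : {set U} := z |: [set y | e z y].

Definition switchable (S : {set U}) (f : U -> V) i : {set U} :=
  [set z in S | [forall x in closed_nbhd z, switch_test i z x (f x)]].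

(** Each new vertex uses up one fresh element of [S]. The neighbours of elements of [S] lie outside
    [S] and never move, so tests evaluated on [phi] stay valid after earlier switches. *)
Lemma absorb_leaves (S : {set U}) (B : {set V}) (phi : U -> V) s2 s1 :
    tree_order e (s2 ++ s1) -> s1 != [::] ->
    {in S, forall z, z \in s1} ->
    {in S, forall z y, e z y -> (y \in s1) && (y \notin S)} ->
    partial_copy s1 phi -> {in s1, forall x, phi x \in B} ->
    (size (s2 ++ s1) <= #|B|)%N ->
    (forall i, (size s2 <= #|switchable S phi i|)%N) ->
  exists f : U -> V, [/\ partial_copy (s2 ++ s1) f,
    {in s2 ++ s1, forall x, f x \in B} & {in s1, forall x, x \notin S -> f x = phi x}].
Proof.
move=> o s10 Ss1 Sind cphi phiB sB good.
(* The induction also tracks the set [Q] of vertices moved so far, at most one per vertex of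
   [s2]. *)
suff [f [Q [QS _ ? ? h]]] : exists f (Q : {set U}), [/\ Q \subset S, (#|Q| <= size s2)%N,
    partial_copy (s2 ++ s1) f, {in s2 ++ s1, forall x, f x \in B} &
    {in s1, forall x, x \notin Q -> f x = phi x}].
  exists f; split=> // x xs1 xS; apply: h => //.
  by apply: contraNN xS => /(subsetP QS).
elim: s2 o sB good => [|a s2 IH] o sB good.
  by exists phi, set0; rewrite sub0set cards0.
have os : tree_order e (s2 ++ s1) by case/and3P: o.
have an : a \notin s2 ++ s1 by case/and3P: o.
have [f [Q [QS cQ cf fB fphi]]] := IH os (ltnW sB) (fun i => ltnW (good i)).
have [y ys eay] : exists2 y, y \in s2 ++ s1 & e a y.
  by apply: (tree_order_parent o); case: (s2) s10 => //; case: (s1).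
have [b bB bf] : exists2 b, b \in B & {in s2 ++ s1, forall u, f u != b}.
  have /subsetPn[b bB bF] : ~~ (B \subset [set x in map f (s2 ++ s1)]).
    apply/negP => /subset_leq_card; apply/negP; rewrite -ltnNge.
    apply: leq_trans sB; rewrite /= ltnS -(size_map f).
    by apply: leq_trans (card_size _); apply/subset_leq_card/subsetP => x; rewrite inE.
  exists b => // u us; apply: contraNneq bF => <-.
  by rewrite inE map_f.
(* The test is indexed by the free vertex [b], the image of the parent [y], and the direction of the
   edge between [y] and [a]. *)
have [z zG zQ] : exists2 z, z \in switchable S phi (b, f y, T y a) & z \notin Q.
  apply/subsetPn/negP => /subset_leq_card; apply/negP; rewrite -ltnNge.
  exact: leq_ltn_trans cQ (good _).
move: zG; rewrite inE => /andP[zS /forall_inP zG].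
have zs1 := Ss1 z zS.
have zs : z \in s2 ++ s1 by rewrite mem_cat zs1 orbT.
have fz : f z = phi z by exact: fphi.
have fu u : e z u -> u \in s1 /\ f u = phi u.
  move=> /(Sind z zS)/andP[us1 uS]; split=> //; apply: fphi => //.
  by apply: contraNN uS => /(subsetP QS).
(* All neighbours of [z] are already listed, whereas [a] is new; hence moving [z] leaves the parent
   of [a] in place. *)
have yz : y != z.
  apply: contraNneq an => yz; have /fu[] : e z a by rewrite -yz underlying_sym.
  by rewrite mem_cat orbC => ->.
have za : z != a by apply: contraNneq an => <-.
pose f1 := [eta f with z |-> b].
have cf1 : partial_copy (z :: s2 ++ s1) f1.
  apply: partial_copy_update => // u us uz ezu.
  have [us1 ->] := fu u ezu.
  have := zG u; rewrite !inE ezu orbT /switch_test (negbTE uz) inE => /(_ isT).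
  have := T_asym z u; move: ezu; rewrite /e /underlying /=.
  by case: (T z u); case: (T u z).
exists [eta f1 with a |-> f z], (z |: Q).
have zGz : f z \in nbr (T y a) (f y).
  have := zG z; rewrite !inE eqxx => /(_ isT).
  by rewrite /switch_test eqxx fz inE.
split.
- by rewrite subUset sub1set zS.
- by rewrite cardsU1 zQ.
- have sub : {subset a :: s2 ++ s1 <= a :: z :: s2 ++ s1}.
    by move=> u; rewrite !inE => /orP[->|->]; rewrite ?orbT.
  suff [inj hom] : partial_copy [:: a, z & s2 ++ s1] [eta f1 with a |-> f z].
    by split=> u v /sub us /sub vs; [exact: inj|exact: hom].
  apply: partial_copy_update => // u; rewrite inE => us.
    rewrite /f1 /=; case: eqVneq us => [_ _|uz /= us]; first by rewrite eq_sym bf.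
    by apply: contra_neq uz => fuz; case: cf => inj _; apply: inj.
  move=> ua eau; have us' : u \in s2 ++ s1 by case/orP: us => // /eqP->.
  have -> : u = y by apply: tree_order_parent_unique o us' ys eau eay.
  by rewrite /f1 /= (negbTE yz).
- move=> u; rewrite inE /= /f1 /=.
  case: eqVneq => [_ _|_ /= us]; first exact: fB.
  by case: eqVneq => // _; exact: fB.
- move=> u us1; rewrite !inE negb_or => /andP[uz uQ].
  rewrite /f1 /= (negbTE uz) ifN; first exact: fphi.
  by apply: contraNneq an => <-; rewrite mem_cat us1 orbT.
Qed.

(** Two sets of density [2^-1 + a] meet in density at least [2 * a]. The used vertices take up at
    most [a], so density [a] remains for every test and [potential_step] applies. *)
Lemma greedy_embedding (R : realType) (I : finType) (S : {set U}) (N : U -> {set U})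
    (G : I -> U -> U -> pred V) (a lam : R) (s : seq U) (v0 : V) :
    0 < a <= 1 -> 0 <= lam ->
    (forall d w, (2^-1 + a) * #|V|%:R <= #|nbr d w|%:R) ->
    (forall i z x, (2^-1 + a) * #|V|%:R <= #|G i z x|%:R) ->
    (forall x, lam * #|touched S N x|%:R <= 2^-1) ->
    tree_order e s -> (size s)%:R <= a * #|V|%:R ->
  exists2 f, partial_copy s f & potential S N G a lam s f <=
    potential S N G a lam [::] (fun=> v0) *
    expR (2 * lam ^+ 2 * \sum_(x <- s) #|touched S N x|%:R ^+ 2).
Proof.
move=> /andP[a0 a1] lam0 degD degG small.
have V0 : (0 < #|V|%:R :> R) by rewrite ltr0n; apply/card_gt0P; exists v0.
elim: s => [|x s IH] o sz.
  by exists (fun=> v0); [split|rewrite big_nil mulr0 expR0 mulr1].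
have os : tree_order e s by case/and3P: o.
have xn : x \notin s by case/and3P: o.
have szs : (size s)%:R <= a * #|V|%:R.
  by apply: le_trans sz; rewrite ler_nat /=.
have [f cf pf] := IH os szs.
(* The root has no parent and may go anywhere; any other vertex must go into one neighbourhood of
   its parent's image. *)
have [W degW adjW] : exists2 W : {set V}, (2^-1 + a) * #|V|%:R <= #|W|%:R :> R &
    forall v, v \in W -> {in s, forall y, e x y -> v \in nbr (T y x) (f y)}.
  case: (eqVneq s [::]) => [s0|s0].
    exists setT; last by move=> v _ y; rewrite s0.
    by apply: le_trans (degD true v0) _; rewrite ler_nat cardsT max_card.
  have [y ys exy] := tree_order_parent o s0.
  exists (nbr (T y x) (f y)) => // v vW u us exu.
  by rewrite (tree_order_parent_unique o us ys exu exy).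
pose F := [set u in map f s].
have cF : (#|F| <= size s)%N.
  rewrite -(size_map f); apply: leq_trans (card_size _).
  by apply/subset_leq_card/subsetP => u; rewrite inE.
have dense (P : pred V) : (2^-1 + a) * #|V|%:R <= #|P|%:R ->
    a * #|V|%:R <= #|[set v in W :\: F | P v]|%:R.
  move=> degP.
  have h : (#|W| + #|P| <= #|V| + (#|[set v in W :\: F | P v]| + #|F|))%N.
    rewrite -(cardsE P) -cardsUI leq_add ?max_card //.
    apply: leq_trans (leq_card_setU _ _).
    apply/subset_leq_card/subsetP => v; rewrite !inE => /andP[-> vP].
    by rewrite andbT orbC; case: (v \in _).
  move: h szs; rewrite -(ler_nat R) !natrD => h szs.
  have : #|F|%:R <= (size s)%:R :> R by rewrite ler_nat.
  lra.
have C0 : (0 < #|W :\: F|)%N.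
  rewrite -(ltr0n R); apply: lt_le_trans (mulr_gt0 a0 V0) _.
  apply: le_trans (dense [in W] _) _; first by [].
  by rewrite ler_nat; apply/subset_leq_card/subsetP => v; rewrite inE => /andP[].
have [v vC pv] : exists2 v, v \in W :\: F &
    potential S N G a lam (x :: s) [eta f with x |-> v] <=
    potential S N G a lam s f * expR (2 * (lam * #|touched S N x|%:R) ^+ 2).
  apply: potential_step => //; first by rewrite (ltW a0).
  move=> i z; apply: le_trans (dense _ (degG i z x)).
  by rewrite ler_pM2l // ler_nat max_card.
exists [eta f with x |-> v].
  move: vC; rewrite !inE => /andP[vF vW].
  apply: partial_copy_update => // y ys.
    by apply: contraNneq vF => <-; rewrite map_f.
  by move=> _; apply: adjW.
apply: le_trans pv _; rewrite big_cons.
have -> (p q r : R) : 2 * p ^+ 2 * (q ^+ 2 + r) = 2 * p ^+ 2 * r + 2 * (p * q) ^+ 2.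
  by ring.
by rewrite expRD mulrA ler_wpM2r ?expR_ge0.
Qed.

End Copies.

(** * Degree bounds in [D] and for the switching set *)

Lemma min_semidegree_le (V : finType) (D : rel V) (d : bool) (w : V) :
  (min_semidegree D <= #|nbr D d w|)%N.
Proof.
have h : (min_semidegree D <= minn (indeg D w) (outdeg D w))%N.
  rewrite /min_semidegree; have : w \in index_enum V by rewrite mem_index_enum.
  elim: (index_enum V) => //= u r IH; rewrite inE big_cons geq_min.
  by case/orP => [/eqP->|/IH->]; rewrite ?leqnn ?orbT.
apply: (leq_trans h); rewrite geq_min /indeg /outdeg.
by case: d; apply/orP; [right|left]; apply/subset_leq_card/subsetP => v; rewrite !inE.
Qed.

Section Touched.
Variables (U : finType) (T : rel U) (S : {set U}).
Let N := closed_nbhd T.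

Lemma card_touched x : (#|touched S N x| <= (max_total_degree T).+1)%N.
Proof.
apply: (@leq_trans #|x |: [set y | underlying T x y]|).
  apply/subset_leq_card/subsetP => z; rewrite !inE => /andP[_].
  by rewrite eq_sym underlying_sym.
rewrite cardsU1 -add1n leq_add ?leq_b1 // cardsE.
exact: (leq_bigmax (F := fun x => #|[pred y | underlying T x y]|)).
Qed.

Hypothesis S_deg : {in S, forall z, (#|[pred y | underlying T z y]| <= 3)%N}.

Lemma card_closed_nbhd z : z \in S -> (#|N z| <= 4)%N.
Proof.
move=> /S_deg h; rewrite cardsU1 -[4%N]/(1 + 3)%N leq_add ?leq_b1 //.
by rewrite cardsE.
Qed.

(** One factor of each square is at most the maximum degree plus 1; the remaining sum is
    [\sum_(z in S) #|N z|] by double counting. *)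
Lemma sum_touched_sqr s : uniq s ->
  (\sum_(x <- s) #|touched S N x| ^ 2 <= (max_total_degree T).+1 * (4 * #|S|))%N.
Proof.
move=> us; apply: (@leq_trans (\sum_(x : U) #|touched S N x| ^ 2)).
  by rewrite big_uniq //= [X in (_ <= X)%N](bigID [in s]) /= leq_addr.
apply: (@leq_trans (\sum_(x : U) (max_total_degree T).+1 * #|touched S N x|)).
  by apply: leq_sum => x _; rewrite -mulnn leq_mul2r card_touched orbT.
rewrite -big_distrr /= leq_mul2l; apply/orP; right.
have -> : (\sum_(x : U) #|touched S N x| = \sum_(z in S) #|N z|)%N.
  under eq_bigr => x _ do rewrite -sum1dep_card big_mkcondr /=.
  rewrite exchange_big /=; apply: eq_bigr => z _.
  by rewrite -sum1_card [RHS]big_mkcond.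
rewrite mulnC -sum_nat_const; apply: leq_sum => z; exact: card_closed_nbhd.
Qed.

End Touched.

(** * Construction of [A] under numerical hypotheses *)

Lemma exists_absorbing_set (R : realType) (U V : finType) (T : rel U) (D : rel V)
    (t : U) (v0 : V) (a lam : R) (k : nat) :
    0 < a <= 1 -> 0 <= lam -> is_oriented_tree T ->
    (forall d w, (2^-1 + a) * #|V|%:R <= #|nbr D d w|%:R) ->
    #|U|%:R <= a * #|V|%:R -> (0 < k <= #|U|)%N ->
    lam * (max_total_degree T).+1%:R <= a ^+ 4 / 32 ->
    (forall c : nat, (#|U| <= 4 * (c + 2 * (#|U| - k) + 1))%N ->
       2 * #|V|%:R ^+ 2 < expR (lam * (a ^+ 4 * c%:R / 4)) /\
       (#|U| - k)%:R <= a ^+ 4 * c%:R / 2) ->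
  exists (A : {set V}) (v : V),
    [/\ #|A| = k, v \in A
      & forall B : {set V}, A \subset B -> #|B| = #|U| ->
          exists f : U -> {x : V | x \in B},
            is_copy T (induced D B) f /\ val (f t) = v].
Proof.
move=> a01 lam0 [T_asym [_ _ _ conn acyc]] deg sizeU /andP[k0 kU] small large.
have /andP[a0 a1] := a01.
set e := underlying T in conn acyc.
have [r [o sz]] := tree_order_exists (underlying_sym T) acyc t conn.
set s := rcons r t in o sz.
have us := tree_order_uniq o.
have ms x : x \in s.
  have /subset_cardP : #|s| = #|U| by rewrite (card_uniqP us).
  by rewrite subset_predT => /(_ isT) ->.
pose s2 := take (#|U| - k) s; pose s1 := drop (#|U| - k) s.
have sE : s = s2 ++ s1 by rewrite cat_take_drop.
have ss1 : size s1 = k by rewrite size_drop sz subKn.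
have ss2 : size s2 = (#|U| - k)%N by rewrite size_take_min sz; apply/minn_idPl/leq_subr.
have s10 : s1 != [::] by rewrite -size_eq0 ss1 -lt0n.
have ts1 : t \in s1.
  have := mem_last t s1; rewrite inE; case: (s1) s10 sE => // b q _ sE _.
  have -> : t = last t s by rewrite last_rcons.
  by rewrite sE last_cat /= mem_last.
have [o' sz'] : tree_order e (s2 ++ s1) /\ size (s2 ++ s1) = #|U| by rewrite -sE.
have [S [tS S3 Ss1 Sind cS]] := exists_switching_set (underlying_sym T)
  (underlying_irr T_asym) t o' sz'.
(* The size of [S] is known only through [cS], which is why [large] ranges over all [c] satisfying
   that bound. *)
rewrite ss2 in cS; have [big1 big2] := large _ cS.
have o1 := tree_order_catr o'.
pose N := closed_nbhd T.
have a4 : 0 <= a ^+ 4 <= 1 by rewrite exprn_ge0 ?exprn_ile1 // ltW.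
have small1 x : lam * #|touched S N x|%:R <= 2^-1.
  apply: (@le_trans _ _ (a ^+ 4 / 32)); last by lra.
  by apply: le_trans small; rewrite ler_wpM2l // ler_nat card_touched.
have [phi cphi pphi] : exists2 f, partial_copy T D s1 f &
    potential S N (switch_test T D) a lam s1 f <=
    potential S N (switch_test T D) a lam [::] (fun=> v0) *
    expR (2 * lam ^+ 2 * \sum_(x <- s1) #|touched S N x|%:R ^+ 2).
  apply: greedy_embedding => //.
  - move=> i z x; rewrite /switch_test; apply: le_trans (deg (if x == z then i.2 else T z x)
      (if x == z then i.1.2 else i.1.1)) _.
    by case: (x == z).
  - by apply: le_trans sizeU; rewrite ler_nat ss1.
(* The threshold [a ^+ 4 * #|S| / 2] is half of the initial lower bound on the expectation, where
   the exponent 4 bounds [#|N z|]. *)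
have good i : (size s2 <= #|switchable T D S phi i|)%N.
  rewrite -(ler_nat R) ss2; apply: le_trans big2 _; apply: ltW.
  have a01' : 0 <= a <= 1 by rewrite ltW.
  apply: (potential_good (G := switch_test T D) (N := N) a01' lam0 (s := s1)).
  - apply: le_lt_trans pphi _.
    have tau : a ^+ 4 * #|S|%:R <= \sum_(z in S) a ^+ #|N z|.
      rewrite mulr_natr -sumr_const; apply: ler_sum => z zS.
      by rewrite ler_wiXn2l // ?ltW // (card_closed_nbhd S3).
    have start := potential_nil (switch_test T D) lam0 (fun=> v0) tau.
    have growth : 2 * lam ^+ 2 * \sum_(x <- s1) #|touched S N x|%:R ^+ 2 <=
        lam * (a ^+ 4 * #|S|%:R / 4).
      have := sum_touched_sqr S3 (tree_order_uniq o1).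
      rewrite -(ler_nat R) natr_sum !natrM.
      under eq_bigr => x _ do rewrite natrX.
      move=> /(ler_wpM2l (mulr_ge0 (ler0n R 2) (sqr_ge0 lam))) h.
      apply: le_trans h _.
      have := ler_wpM2l (mulr_ge0 lam0 (ler0n R #|S|)) small.
      lra.
    (* There are [2 * #|V| ^ 2] tests. The growth costs a quarter of the exponent and the threshold
       a half, so the last quarter must beat the number of tests, as [big1] says. *)
    apply: (@le_lt_trans _ _ (2 * #|V|%:R ^+ 2 * expR (- (lam * (a ^+ 4 * #|S|%:R))) *
        expR (lam * (a ^+ 4 * #|S|%:R / 4)))).
      apply: ler_pM; rewrite ?expR_ge0 ?ler_expR //.
        by apply: sumr_ge0 => j _; exact: expR_ge0.
      by apply: le_trans start _; rewrite !card_prod card_bool !natrM expr2 [_ * 2]mulrC.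
    have -> : - (lam * (a ^+ 4 * #|S|%:R / 2)) =
        lam * (a ^+ 4 * #|S|%:R / 4) + (- (lam * (a ^+ 4 * #|S|%:R)) +
        lam * (a ^+ 4 * #|S|%:R / 4)) by field.
    by rewrite !expRD -mulrA ltr_pM2r // mulr_gt0 ?expR_gt0.
  - move=> z zS x; rewrite !inE => /orP[/eqP->|]; first exact: Ss1.
    by move=> /(Sind z zS)/andP[].
(* As [t] is in [s1] but not in [S], no switch moves it, whatever [B] is. *)
exists [set phi x | x in s1], (phi t); split.
- rewrite card_in_imset; last by case: cphi.
  by rewrite (card_uniqP (tree_order_uniq o1)).
- exact: imset_f.
move=> B AB cB.
have phiB : {in s1, forall x, phi x \in B}.
  by move=> x xs; apply: (subsetP AB); exact: imset_f.
have szB : (size (s2 ++ s1) <= #|B|)%N by rewrite sz' cB.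
have [f [[inj hom] fB fphi]] := absorb_leaves T_asym o' s10 Ss1 Sind cphi phiB szB good.
have ms' x : x \in s2 ++ s1 by rewrite -sE.
exists (fun x => exist _ (f x) (fB x (ms' x))); split; last by rewrite /= fphi.
split=> [x y /(congr1 val) /= /inj|x y Txy]; first by apply.
exact: hom.
Qed.

(** * Choice of the constants *)

Lemma ln_le_linear (R : realType) (c x : R) :
  0 < c -> 0 < x -> 4 / c ^+ 2 <= x -> ln x <= c * x.
Proof.
move=> c0 x0; rewrite ler_pdivrMr ?exprn_gt0 // => h.
rewrite -ler_expR lnK ?posrE //.
(* Splitting the exponent gives [expR (c * x) >= (c * x / 2) ^+ 2], which is at least [x] by [h]. *)
have -> : c * x = c * x / 2 + c * x / 2 by field.
rewrite expRD.
have p0 : 0 <= c * x / 2 by rewrite divr_ge0 ?mulr_ge0 ?ltW.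
have h1 : 1 + c * x / 2 <= expR (c * x / 2) by exact: expR_ge1Dx.
have h2 : (c * x / 2) * (c * x / 2) <= expR (c * x / 2) * expR (c * x / 2).
  by apply: ler_pM => //; lra.
apply: le_trans h2.
have := ler_wpM2r (ltW x0) h; lra.
Qed.

Theorem theorem2p1 (R : realType) :
  forall alpha : R, 0 < alpha <= 1 ->
  exists2 mu0 : R, 0 < mu0 & forall mu : R, 0 < mu <= mu0 ->
  exists2 eps0 : R, 0 < eps0 & forall eps : R, 0 < eps <= eps0 ->
  exists2 c0 : R, 0 < c0 & forall c : R, 0 < c <= c0 ->
  exists n0 : nat, forall n : nat, (n0 <= n)%N ->
  forall (V : finType) (D : rel V),
    #|V| = n ->
    irreflexive D ->
    (1 / 2 + alpha) * n%:R <= (min_semidegree D)%:R ->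
  forall (U : finType) (T : rel U) (t : U),
    is_oriented_tree T ->
    #|U| = Num.truncn (mu * n%:R) ->
    (max_total_degree T)%:R <= c * n%:R / ln (n%:R) ->
  exists (A : {set V}) (v : V),
    [/\ #|A| = Num.truncn ((mu - eps) * n%:R),
        v \in A
      & forall B : {set V},
          A \subset B ->
          #|B| = Num.truncn (mu * n%:R) ->
          exists f : U -> {x : V | x \in B},
            is_copy T (induced D B) f /\ val (f t) = v].
Proof.
move=> a a01; have /andP[a0 a1] := a01.
(* With [mu <= a] the tree has at most [a * n] vertices, as the greedy embedding needs. *)
exists a => // mu /andP[mu0 mua].
have [b bE] : exists b, b = a ^+ 4 by exists (a ^+ 4).
have b0 : 0 < b by rewrite bE exprn_gt0.
have b1 : b <= 1 by rewrite bE exprn_ile1 // ltW.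
have bmu0 : 0 < b * mu by rewrite mulr_gt0.
have bmu : b * mu <= mu by rewrite ger_pMl.
(* This keeps the part of [T] outside the prefix small enough for a switching set of size at least
   [mu * n / 8], and for half its expected good vertices to cover that part. *)
exists (b * mu / 64); first by rewrite divr_gt0.
move=> eps /andP[eps0 epsb].
(* With [lam = K * ln n / n] this makes the exponent in [large] at least [3 * ln n], so that [n ^ 3]
   beats [2 * n ^ 2]. *)
have [K KE] : exists K, K = 96 / (b * mu) by exists (96 / (b * mu)).
have K0 : 0 < K by rewrite KE divr_gt0.
(* The degree condition becomes [2 * c * K <= b / 32]. *)
exists (b / (64 * K)); first by rewrite divr_gt0 ?mulr_gt0.
move=> c /andP[c0]; rewrite ler_pdivlMr ?mulr_gt0 // => cK.
(* The three summands absorb the rounding errors, give [ln n <= c * n], and ensure [n > 3]. *)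
exists (Num.truncn (64 / (b * mu) + 4 / c ^+ 2 + 3)).+1 => n n_large V D cV _ degD U T t treeT cU degT.
set x : R := n%:R in degD cU degT *.
have x_large : 64 / (b * mu) + 4 / c ^+ 2 + 3 < x.
  by apply: lt_le_trans (truncnS_gt _) _; rewrite ler_nat.
have q1 : 0 < 64 / (b * mu) by rewrite divr_gt0.
have q2 : 0 < 4 / c ^+ 2 by rewrite divr_gt0 ?exprn_gt0.
have x3 : 3 < x by lra.
have x0 : 0 < x by lra.
have bmux : 64 < b * mu * x.
  have : 64 / (b * mu) < x by lra.
  by rewrite ltr_pdivrMr // mulrC.
have epsx : eps * x <= b * mu * x / 64.
  by have := ler_wpM2r (ltW x0) epsb; lra.
have bmux' : b * mu * x <= mu * x by rewrite ler_pM2r.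
have lnx : ln x <= c * x by apply: ln_le_linear => //; lra.
have lnx0 : 0 < ln x by rewrite ln_gt0 //; lra.
set k := Num.truncn ((mu - eps) * x).
have k_le : k%:R <= (mu - eps) * x by rewrite truncn_le; lra.
have k_gt : (mu - eps) * x < k%:R + 1 by rewrite natr1 truncnS_gt.
have U_le : #|U|%:R <= mu * x by rewrite cU truncn_le; lra.
have U_gt : mu * x < #|U|%:R + 1 by rewrite cU natr1 truncnS_gt.
have kU : (k <= #|U|)%N by rewrite cU; apply: le_truncn; nra.
have k0 : (0 < k)%N by rewrite -(ltr_nat R); lra.
have [v0 _] : exists v0, v0 \in V by apply/card_gt0P; rewrite cV -(ltr_nat R).
(* Since [c * x / ln x] is at least 1, doubling it absorbs the extra 1 in the degree. *)
have cdeg : (max_total_degree T).+1%:R <= 2 * (c * x / ln x).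
  have : 1 <= c * x / ln x by rewrite ler_pdivlMr // mul1r.
  rewrite -natr1; lra.
rewrite -cU; apply: (exists_absorbing_set (R := R) (a := a) (lam := K * ln x / x) t v0) => //.
- by rewrite divr_ge0 ?mulr_ge0 // ltW.
- move=> d w; rewrite cV -/x -div1r; apply: le_trans degD _.
  by rewrite ler_nat min_semidegree_le.
- by rewrite cV -/x; apply: le_trans U_le _; rewrite ler_pM2r.
- by rewrite k0.
- have lam0 : 0 <= K * ln x / x by rewrite divr_ge0 ?mulr_ge0 // ltW.
  apply: le_trans (ler_wpM2l lam0 cdeg) _.
  have -> : K * ln x / x * (2 * (c * x / ln x)) = 2 * (c * K).
    by field; rewrite !gt_eqF.
  rewrite -bE; lra.
move=> s; rewrite -(ler_nat R) !(natrM, natrD) natrB // => hs.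
have s_large : mu * x / 8 <= s%:R by lra.
have bs_large : b * (mu * x / 8) <= b * s%:R by rewrite ler_pM2l.
split; last by rewrite -bE; lra.
rewrite cV -/x -bE.
apply: (@lt_le_trans _ _ (expR (ln x + ln x + ln x))).
  rewrite !expRD lnK ?posrE // expr2 mulrA ltr_pM2r // ltr_pM2r //; lra.
rewrite ler_expR.
apply: (@le_trans _ _ (K * ln x / x * (b * (mu * x / 8) / 4))).
  rewrite KE le_eqVlt; apply/orP; left; apply/eqP; field.
  by rewrite !gt_eqF.
by apply: ler_wpM2l; [rewrite divr_ge0 ?mulr_ge0 // ltW|lra].
Qed.
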